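(* Let $\theta$ be an uncountable cardinal. The following are equivalent: (1) There exists a $\theta$-good subset of $F_{\theta,\omega}\times F_{\theta,\omega}$. (2) There exists a topological space $X$ that is first countable, $<\!\theta$-collectionwise Hausdorff and not $\le\!\theta$-collectionwise Hausdorff. (3) There exists a family $\mathcal{H}=\{H_{\alpha\beta}:\alpha<\beta<\theta\}\subseteq[\omega\times\omega]^{<\omega}$, with each $H_{\alpha\beta}$ closed downward, such that (a) for every $A\in[\theta]^{<\theta}$ there is a function $f:\theta\to\omega$ such that for all $\alpha<\beta$ in $A$, $(f(\alpha),f(\beta))\notin H_{\alpha\beta}$; and (b) for every $f:\theta\to\omega$ there are $\alpha<\beta<\theta$ such that $(f(\alpha),f(\beta))\in H_{\alpha\beta}$. (4) There exists a topological space $X$ that is first countable, zero-dimensional, $<\!\theta$-collectionwise Hausdorff and not $\le\!\theta$-collectionwise Hausdorff.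
   Context: A subset $A$ of a topological space $X$ can be separated if there is a family $\{U_x:x\in A\}$ of pairwise disjoint open sets with $x\in U_x$ for each $x\in A$. $X$ is $<\!\theta$-collectionwise Hausdorff if every closed discrete subset of size $<\theta$ can be separated, and $\le\!\theta$-collectionwise Hausdorff if every closed discrete subset of size $\le\theta$ can be separated. The fan $F_{\theta,\omega}$ is the set $\{*\}\cup(\theta\times\omega)$ in which points of $\theta\times\omega$ are isolated and a neighbourhood base at $*$ consists of the sets $B_f=\{*\}\cup\{(\alpha,n):n\ge f(\alpha)\}$ for $f\in{}^\theta\omega$ (equivalently, the quotient of $\theta$ disjoint convergent $\omega$-sequences with their limit points identified). In $F_{\theta,\omega}\times F_{\theta,\omega}$ (product topology), a set $S$ is $\theta$-good if $( *,* )$ is in the closure of $S$ but $( *,* )$ is not in the closure of any $T\in[S]^{<\theta}$. A set $H\subseteq\omega\times\omega$ is closed downward if whenever $(n,m)\in H$, $n'\le n$ and $m'\le m$, then $(n',m')\in H$. $[\omega\times\omega]^{<\omega}$ denotes the finite subsets of $\omega\times\omega$. *)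

(* Defs.v *)
From HB Require Import structures.
From mathcomp Require Import all_boot all_order.
From mathcomp Require Import all_classical topology.

Set Implicit Arguments.
Unset Strict Implicit.
Unset Printing Implicit Defensive.

Local Open Scope classical_set_scope.
Local Open Scope card_scope.

Definition card_lt (T U : Type) (A : set T) (B : set U) : Prop :=
  A #<= B /\ ~ (B #<= A).

(* An infinite cardinal, taken to be an initial ordinal, is presented by a
   well-ordered type each of whose proper initial segments has strictly smaller
   cardinality; the elements of the type are the ordinals below the cardinal. *)
Definition cardinal_order (d : Order.disp_t) (Theta : orderType d) : Prop :=
  wochoice.well_order (<=%O : rel Theta) /\
  forall a : Theta, card_lt [set b : Theta | (b < a)%O] [set: Theta].

Section collectionwise_Hausdorff.
Variable X : topologicalType.

Definition first_countable : Prop :=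
  forall x : X, exists2 B : set (set X), countable B &
    B `<=` nbhs x /\ filter_from B id --> x.

(* Zero-dimensionality; no separation axiom is included.  The library's
   zero_dimensional is a different notion: it asks that any two distinct points
   be separated by a clopen set, which does not yield a base of clopen sets. *)
Definition has_clopen_basis : Prop :=
  exists2 B : set (set X), basis B & B `<=` clopen.

Definition closed_discrete (A : set X) : Prop :=
  closed A /\ A `<=` isolated A.

(* Not the library's separated, which relates two sets. *)
Definition can_be_separated (A : set X) : Prop :=
  exists U : X -> set X,
    (forall x, A x -> open (U x) /\ U x x) /\ trivIset A U.

(* In the next two definitions the cardinal theta is that of the type T. *)
Definition lt_cwHausdorff (T : Type) : Prop :=
  forall A : set X, closed_discrete A -> card_lt A [set: T] ->
    can_be_separated A.

Definition le_cwHausdorff (T : Type) : Prop :=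
  forall A : set X, closed_discrete A -> A #<= [set: T] ->
    can_be_separated A.

End collectionwise_Hausdorff.

Definition fan (T : choiceType) : Type := option (T * nat).

Section fan.
Variable T : choiceType.
Local Notation fan := (fan T).

HB.instance Definition _ := Choice.on fan.

Definition fan_star : fan := None.

Definition fan_ball (f : T -> nat) : set fan :=
  [set p : fan | if p is Some (a, n) then f a <= n else True].

Definition fan_nbhs (p : fan) : set_system fan :=
  if p is Some _ then principal_filter p else filter_from [set: T -> nat] fan_ball.

Let fan_nbhs_filter (p : fan) : ProperFilter (fan_nbhs p).
Proof.
case: p => [p|] /=; first exact: principal_filter_proper.
apply: filter_from_proper; last by move=> f _; exists None.
apply: filter_from_filter; first by exists (fun=> 0).
move=> f g _ _; exists (fun a => maxn (f a) (g a)) => // -[[a n]|] //=.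
by rewrite geq_max => /andP[].
Qed.

Let fan_nbhs_singleton (p : fan) (A : set fan) : fan_nbhs p A -> A p.
Proof. by case: p => [p /principal_filterP|[f _]]; exact. Qed.

Let fan_nbhs_nbhs (p : fan) (A : set fan) :
  fan_nbhs p A -> fan_nbhs p (fan_nbhs^~ A).
Proof.
case: p => [p|] /=; first by move=> Ap; apply/principal_filterP.
move=> [f _ fA]; exists f => // -[[a n]|] /= fan_n; last by exists f.
by apply/principal_filterP; exact: fA.
Qed.

HB.instance Definition _ := hasNbhs.Build fan fan_nbhs.
HB.instance Definition _ := @Nbhs_isNbhsTopological.Build fan
  fan_nbhs_filter fan_nbhs_singleton fan_nbhs_nbhs.

(* The cardinal theta is that of T. *)
Definition theta_good (S : set (fan * fan)%type) : Prop :=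
  closure S (fan_star, fan_star) /\
  forall S' : set (fan * fan)%type, S' `<=` S -> card_lt S' [set: T] ->
    ~ closure S' (fan_star, fan_star).

End fan.

Definition closed_downward (H : set (nat * nat)) : Prop :=
  forall n m n' m' : nat, H (n, m) -> n' <= n -> m' <= m -> H (n', m').

(* Main.v *)
(* All four statements reduce to a weakening of (3) in which the sets
   [H a b] are downward closed but possibly infinite.  A good set [S] yields
   such a family by taking the downward closure of the pairs [(n, m)] with
   [((a, n), (b, m))] in [S] up to symmetry, a space by recording which basic
   neighbourhoods of the points of a non-separated closed discrete set meet.
   Since countable sets are small, for every [a] some level [F a] makes all
   sections of the [H a b] and [H b a] at [F a] bounded; shifting [H a b] by
   [(F a, F b)] then makes it finite.  From a finite family one reads off a good
   set directly, and a space whose non-isolated points are the elements of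
   [Theta], the basic neighbourhoods of [a] and [b] of indices [n] and [m] meeting
   exactly when [(n, m)] is in [H a b]; finiteness makes these sets clopen. *)
From HB Require Import structures.
Require Import Defs.
From mathcomp Require Import all_boot all_order.
From mathcomp Require Import all_classical topology.
Set Implicit Arguments.
Unset Strict Implicit.
Unset Printing Implicit Defensive.
Import Order.TTheory.
Local Open Scope classical_set_scope.

(** * Cardinal arithmetic *)

Local Open Scope card_scope.

(** A partial inverse of [R], chosen pointwise and extended by a default [x0], sends [B] onto a
    superset of [A]. *)
Lemma card_le_rel {T U : Type} {A : set T} {B : set U} (R : T -> U -> Prop) :
    (forall x, A x -> exists2 y, B y & R x y) ->
    (forall x x' y, A x -> A x' -> R x y -> R x' y -> x = x') ->
  A #<= B.
Proof.
move=> AB Rinj; have [->|/set0P[x0 _]] := eqVneq A set0; first exact: card_ge0.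
pose g y := if pselect (exists x, A x /\ R x y) is left e
            then projT1 (cid e) else x0.
apply: card_le_trans (card_image_le g B); apply: subset_card_le => x Ax.
have [y By Rxy] := AB x Ax; exists y => //; rewrite /g.
case: pselect => [e|[]]; last by exists x.
by have [Ax' Rx'y] := projT2 (cid e); exact: Rinj Rx'y Rxy.
Qed.

Lemma card_le_inj {T U : Type} {A : set T} {B : set U} (f : T -> U) :
    (forall x, A x -> B (f x)) -> {in A &, injective f} -> A #<= B.
Proof.
move=> AB finj; apply: (@card_le_rel _ _ _ _ (fun x y => f x = y)).
  by move=> x Ax; exists (f x) => //; exact: AB.
by move=> x x' _ Ax Ax' <- fx; apply: finj; rewrite ?inE.
Qed.

(** Turns an injection between subtypes into a total function; a point of [A] supplies the values
    outside [A]. *)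
Lemma card_le_ex {T U : Type} {A : set T} {B : set U} : A !=set0 -> A #<= B ->
  exists f : T -> U, (forall x, A x -> B (f x)) /\ {in A &, injective f}.
Proof.
move=> [x0 Ax0] /card_leP[f].
pose x0' : A := SigSub (mem_set Ax0).
pose F (x : T) : U := val (f (insubd x0' x)).
have insubE x : A x -> val (insubd x0' x) = x.
  by move=> Ax; rewrite insubdK ?inE.
exists F; split => [x Ax|x y]; first by rewrite /F; case: (f _) => u /=; rewrite inE.
rewrite !inE => Ax Ay /val_inj fxy.
have : insubd x0' x = insubd x0' y by apply: (@inj _ _ _ f _ _ _ _ fxy); rewrite inE.
by move=> /(congr1 val); rewrite !insubE.
Qed.

(** By Zorn there is a maximal graph of a partial injection from [A] to [B]. It is total on [A] or
    onto [B], since otherwise a pair of unmatched points could be added. *)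
Lemma card_le_total {T U : Type} (A : set T) (B : set U) : A #<= B \/ B #<= A.
Proof.
pose P (R : set (T * U)) := [/\ R `<=` A `*` B,
  forall x y y', R (x, y) -> R (x, y') -> y = y' &
  forall x x' y, R (x, y) -> R (x', y) -> x = x'].
have [F FP Ftot|R [[RAB Rfun Rinj] Rmax]] := @Zorn_bigcup _ P.
  (* Each condition in [P] involves at most two pairs, and any two pairs of the union of a chain lie
     in one member. *)
  have two p q : (\bigcup_(X in F) X) p -> (\bigcup_(X in F) X) q ->
      exists X, [/\ P X, X p & X q].
    move=> [X FX Xp] [Y FY Yq].
    by have [XY|YX] := Ftot X Y FX FY;
      [exists Y | exists X]; split => //; try (exact: FP);
      [exact: XY | exact: YX].
  split=> [p [X FX Xp]|x y y' Xy Xy'|x x' y Xy Xy'].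
  - by have [+ _ _] := FP _ FX; exact.
  - by have [X [[_ + _] Xp Xq]] := two _ _ Xy Xy'; apply; eassumption.
  - by have [X [[_ _ +] Xp Xq]] := two _ _ Xy Xy'; apply; eassumption.
have [domA|] := pselect (forall x, A x -> exists y, R (x, y)).
  left; apply: (@card_le_rel _ _ _ _ (fun x y => R (x, y))) => [x Ax|x x' y _ _].
    by have [y Rxy] := domA x Ax; exists y => //; have [] := RAB _ Rxy.
  exact: Rinj.
move=> /existsNP[a /not_implyP[Aa aR]].
have [ranB|] := pselect (forall y, B y -> exists x, R (x, y)).
  right; apply: (@card_le_rel _ _ _ _ (fun y x => R (x, y))) => [y By|y y' x _ _].
    by have [x Rxy] := ranB y By; exists x => //; have [] := RAB _ Rxy.
  exact: Rfun.
move=> /existsNP[b /not_implyP[Bb bR]].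
exfalso; apply: (Rmax (R `|` [set (a, b)])).
  split; first by move=> p; left.
  by move=> /(_ (a, b) (or_intror erefl)) Rab; apply: aR; exists b.
split=> [p [/RAB//|->]//|x y y'|x x' y].
- move=> [Rxy|/pair_equal_spec[ex ey]] [Rxy'|/pair_equal_spec[ex' ey']].
  + exact: Rfun Rxy Rxy'.
  + by case: aR; exists y; rewrite -ex'.
  + by case: aR; exists y'; rewrite -ex.
  + by rewrite ey ey'.
- move=> [Rxy|/pair_equal_spec[ex ey]] [Rxy'|/pair_equal_spec[ex' ey']].
  + exact: Rinj Rxy Rxy'.
  + by case: bR; exists x; rewrite -ey'.
  + by case: bR; exists x'; rewrite -ey.
  + by rewrite ex ex'.
Qed.

Lemma card_le_setX {T T' U U' : Type} (A : set T) (B : set U) (A' : set T')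
    (B' : set U') :
  A #<= A' -> B #<= B' -> A `*` B #<= A' `*` B'.
Proof.
have [->|/set0P A0] := eqVneq A set0; first by rewrite set0X => _ _; exact: card_ge0.
have [->|/set0P B0] := eqVneq B set0; first by rewrite setX0 => _ _; exact: card_ge0.
move=> /(card_le_ex A0)[f [fA fI]] /(card_le_ex B0)[g [gB gI]].
apply: (@card_le_inj _ _ _ _ (fun p => (f p.1, g p.2))) => [p [Ap Bp]|].
  by split; [exact: fA | exact: gB].
move=> [x y] [x' y']; rewrite !inE /= => -[/= Ax By] [/= Ax' By'] [fx gy].
by congr (_, _); [apply: fI|apply: gI]; rewrite ?inE.
Qed.

(** For distinct [c] and [c'] in [C], the disjoint copies [{c} x C] and [{c'} x C] inside the square
    of [C] receive [A] and [B]. *)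
Lemma card_le_setU_square {T U : Type} (A B : set T) (C : set U) :
    infinite_set C -> C `*` C #<= C -> A #<= C -> B #<= C -> A `|` B #<= C.
Proof.
move=> Cinf CC AC BC; apply: card_le_trans CC.
have [c [c' [Cc Cc' cc']]] : exists c c', [/\ C c, C c' & c <> c'].
  move/infiniteP: Cinf => /(@card_le_ex nat _ _ _)[|e [eC eI]]; first by exists 0.
  exists (e 0), (e 1); split; try exact: eC.
  by move=> /eI; rewrite !inE => /(_ I I).
have key (D : set T) : D #<= C -> exists R : T -> U -> Prop,
    (forall x, D x -> exists2 y, C y & R x y) /\
    (forall x x' y, R x y -> R x' y -> x = x').
  have [->|/set0P D0] := eqVneq D set0; first by move=> _; exists (fun _ _ => False).
  move=> /(card_le_ex D0)[f [fD fI]].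
  exists (fun x y => D x /\ f x = y); split; first by move=> x Dx; exists (f x); auto.
  by move=> x x' _ [Dx <-] [Dx' /fI/esym]; apply; rewrite inE.
have [R [RA RI]] := key _ AC; have [S [SB SI]] := key _ BC.
apply: (@card_le_rel _ _ _ _
  (fun x p => p.1 = c /\ R x p.2 \/ p.1 = c' /\ S x p.2)).
  move=> x [/RA[y Cy Rxy]|/SB[y Cy Sxy]].
    by exists (c, y) => //; left.
  by exists (c', y) => //; right.
move=> x x' p _ _ [[-> Rx]|[-> Sx]] [[]|[]] => [_|/cc'//|/esym/cc'//|_].
  exact: RI.
exact: SI.
Qed.

(* The square of an infinite set: the relations that are graphs of injections
   from [D * D] to [D], for [D] a subset of [A], are ordered by inclusion; a
   maximal one containing a fixed graph on a countable [D] has [A `\` D] smaller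
   than [D], as otherwise it extends to the union of [D] with a disjoint copy. *)
Section square.
Variables (T : Type) (A : set T).

(** The set [D] is recovered from the diagonal of the graph. *)
Let dom (R : set (T * T * T)) := [set x | exists z, R (x, x, z)].

Let good (R : set (T * T * T)) := [/\
  forall p z z', R (p, z) -> R (p, z') -> z = z',
  forall p p' z, R (p, z) -> R (p', z) -> p = p',
  forall x y z, R (x, y, z) -> [/\ dom R x, dom R y & dom R z],
  dom R `<=` A &
  forall x y, dom R x -> dom R y -> exists z, R (x, y, z)].

Let good_card R : good R -> dom R `*` dom R #<= dom R.
Proof.
move=> [_ Rinj Rdom _ Rtot].
apply: (@card_le_rel _ _ _ _ (fun p z => R (p, z))) => [[x y] [/= Dx Dy]|].
  by have [z Rz] := Rtot _ _ Dx Dy; exists z => //; have [] := Rdom _ _ _ Rz.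
by move=> p p' z _ _; exact: Rinj.
Qed.

Let good_extend R : good R -> infinite_set (dom R) -> dom R #<= A `\` dom R ->
  exists2 R', R `<` R' & good R'.
Proof.
move=> gR Dinf; have [Rfun Rinj Rdom RA Rtot] := gR.
have D0 : dom R !=set0 by exact: infinite_setN0.
move=> /(card_le_ex D0)[g [gD gI]].
pose C := g @` dom R; pose D' := dom R `|` C.
have CA : C `<=` A `\` dom R by move=> _ [x Dx <-]; exact: gD.
have D'D : D' #<= dom R.
  apply: card_le_setU_square => //; [exact: good_card|exact: card_image_le].
(* The square of [D'] is no larger than [dom R], hence than [C]. Values of [h] lie in [C], so they
   never collide with those of [R], which lie in [dom R]. *)
have [h [hC hI]] : exists h : T * T -> T,
    (forall p, (D' `*` D') p -> C (h p)) /\ {in D' `*` D' &, injective h}.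
  apply: card_le_ex; first by have [x Dx] := D0; exists (x, x); split; left.
  apply: card_le_trans (card_le_setX D'D D'D) _.
  apply: card_le_trans (good_card gR) _.
  by apply: (@card_le_inj _ _ _ _ g) => // x Dx; exists x.
pose R' := R `|` [set q |
  [/\ (D' `*` D') q.1, ~ (dom R `*` dom R) q.1 & q.2 = h q.1]].
have domR' : dom R' = D'.
  apply/seteqP; split=> [x [z [Rz|[[/= D'x _] _ _]//]]|x D'x].
    by left; exists z.
  have [Dx|nDx] := pselect (dom R x); first by have [z Rz] := Dx; exists z; left.
  by exists (h (x, x)); right; split => //= -[].
have RD p z : R (p, z) -> (dom R `*` dom R) p /\ dom R z.
  by case: p => x y /Rdom[].
exists R'.
  split; first by move=> q; left.
  have [x Dx] := D0.
  have Cgx : C (g x) by exists x.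
  have [_ nD] := CA _ Cgx.
  have R'g : R' ((g x, g x), h (g x, g x)).
    by right; split => //=; [split; right|case].
  by move=> /(_ _ R'g)/RD[[]].
split.
- move=> p z z' [Rp|[/= _ np ->]] [Rp'|[/= _ np' ->]] //; first exact: Rfun Rp Rp'.
    by have [] := RD _ _ Rp.
  by have [] := RD _ _ Rp'.
- move=> p p' z [Rp|[/= Dp np ez]] [Rp'|[/= Dp' np' ez']]; first exact: Rinj Rp Rp'.
  + have [_ Dz] := RD _ _ Rp; have := hC _ Dp'.
    by rewrite -ez' => /CA[].
  + have [_ Dz] := RD _ _ Rp'; have := hC _ Dp.
    by rewrite -ez => /CA[].
  + by apply: hI; rewrite ?inE// -ez.
- rewrite domR' => x y z [/Rdom[Dx Dy Dz]|[/= [Dx Dy] _ ->]]; first by split; left.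
  by split => //; right; apply: hC.
- by rewrite domR' => x [/RA//|/CA[]].
- rewrite domR' => x y D'x D'y.
  have [[Dx Dy]|nD] := pselect ((dom R `*` dom R) (x, y)).
    by have [z Rz] := Rtot _ _ Dx Dy; exists z; left.
  by exists (h (x, y)); right.
Qed.

Lemma card_setX_infinite : infinite_set A -> A `*` A #<= A.
Proof.
move=> Ainf; have /infiniteP/(@card_le_ex nat _ _ _)[|e [eA eI]] := Ainf.
  by exists 0.
have {}eA i : A (e i) by exact: eA.
have {}eI : injective e by move=> i j; apply: eI; rewrite inE.
(* The pairing function of the natural numbers, transported along [e]. *)
pose R0 := [set q | exists i j, q = (e i, e j, e (pickle (i, j)))].
have domR0 : dom R0 = range e.
  apply/seteqP; split=> [x [z [i [j [-> _ _]]]]|_ [i _ <-]]; first by exists i.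
  by exists (e (pickle (i, i))), i, i.
have R0good : good R0.
  split.
  - move=> p z z' [i [j [-> ->]]] [i' [j' [/eI -> /eI -> ->]]] //.
  - move=> p p' z [i [j [-> ->]]] [i' [j' [-> /eI]]].
    by move=> /(pcan_inj pickleK)[-> ->].
  - by rewrite domR0 => x y z [i [j [-> -> ->]]].
  - by rewrite domR0 => _ [i _ <-].
  - rewrite domR0 => _ _ [i _ <-] [j _ <-].
    by exists (e (pickle (i, j))), i, j.
(* Zorn is applied to the property that [R] together with [R0] is good: this keeps the domain
   infinite and covers the empty chain. *)
have goodU (F : set (set (T * T * T))) :
    F `<=` (fun R => good (R `|` R0)) -> total_on F subset ->
    good (\bigcup_(X in F) X `|` R0).
  move=> Fgood Ftot; set K := _ `|` R0.
  have two p q : K p -> K q -> exists S, [/\ good S, S `<=` K, S p & S q].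
    have R0K : R0 `<=` K by move=> r; right.
    have FK X : F X -> X `|` R0 `<=` K.
      by move=> FX r [Xr|]; [left; exists X|right].
    move=> [[X FX Xp]|R0p] [[Y FY Yq]|R0q].
    - have [XY|YX] := Ftot X Y FX FY.
        exists (Y `|` R0); split; [exact: Fgood|exact: FK|left; exact: XY|by left].
      exists (X `|` R0); split; [exact: Fgood|exact: FK|by left|left; exact: YX].
    - exists (X `|` R0); split; [exact: Fgood|exact: FK|by left|by right].
    - exists (Y `|` R0); split; [exact: Fgood|exact: FK|by right|by left].
    - by exists R0.
  have domK S : S `<=` K -> dom S `<=` dom K by move=> SK x [z /SK]; exists z.
  split.
  - move=> p z z' Kz Kz'; have [S [[Sfun _ _ _ _] _ Sz Sz']] := two _ _ Kz Kz'.
    exact: Sfun Sz Sz'.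
  - move=> p p' z Kp Kp'; have [S [[_ Sinj _ _ _] _ Sp Sp']] := two _ _ Kp Kp'.
    exact: Sinj Sp Sp'.
  - move=> x y z Kz; have [S [[_ _ Sdom _ _] /domK SK Sz _]] := two _ _ Kz Kz.
    by have [Dx Dy Dz] := Sdom _ _ _ Sz; split; exact: SK.
  - move=> x [z Kz]; have [S [[_ _ _ SA _] _ Sz _]] := two _ _ Kz Kz.
    by apply: SA; exists z.
  - move=> x y [z Kz] [z' Kz'].
    have [S [[_ _ _ _ Stot] SK Sz Sz']] := two _ _ Kz Kz'.
    have [|| w Sw] := Stot x y; [by exists z|by exists z'|].
    by exists w; exact: SK.
have [R' [gR' R'max]] := Zorn_bigcup goodU.
pose R := R' `|` R0; have gR : good R by [].
have [_ _ _ RA _] := gR.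
have Dinf : infinite_set (dom R).
  apply/infiniteP; apply: (@card_le_inj _ _ _ _ e) => [i _|i j _ _ /eI//].
  by exists (e (pickle (i, i))); right; exists i, i.
have [DA|AD] := card_le_total (dom R) (A `\` dom R).
  have [R1 [RR1 R1R] gR1] := good_extend gR Dinf DA.
  exfalso; apply: (R'max R1); last first.
    suff -> : R1 `|` R0 = R1 by [].
    by apply/setUidPl => p R0p; apply: RR1; right.
  split; first by move=> p R'p; apply: RR1; left.
  by move=> R1R'; apply: R1R => p /R1R'; left.
(* Here the part of [A] outside [dom R] is no larger than [dom R], so [A] itself is not, and the
   square of [dom R] bounds that of [A]. *)
have AR : A #<= dom R.
  rewrite -[X in X #<= _](setUIDK A (dom R)).
  apply: card_le_setU_square => //; first exact: good_card.
  by apply: subset_card_le; exact: subIsetr.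
apply: card_le_trans (card_le_setX AR AR) _.
by apply: card_le_trans (good_card gR) _; exact: subset_card_le.
Qed.

End square.

Lemma card_le_setU {T U : Type} (A B : set T) (C : set U) :
  infinite_set C -> A #<= C -> B #<= C -> A `|` B #<= C.
Proof.
by move=> Cinf; apply: card_le_setU_square => //; exact: card_setX_infinite.
Qed.

Section uncountable_card_lt.
Variables (T : Type) (T_uncountable : ~ countable [set: T]).

Lemma countable_card_lt {U : Type} (A : set U) : countable A -> card_lt A [set: T].
Proof.
move=> cA; have TA : ~ ([set: T] #<= A).
  by move=> TA; apply: T_uncountable; exact: sub_countable cA.
by split => //; have [] := card_le_total A [set: T].
Qed.

Lemma card_le_lt {U V : Type} (A : set U) (B : set V) :
  A #<= B -> card_lt B [set: T] -> card_lt A [set: T].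
Proof.
move=> AB [BT TB]; split; first exact: card_le_trans BT.
by move=> TA; apply: TB; exact: card_le_trans AB.
Qed.

Lemma card_lt_setX_nat {U : Type} (A : set U) : card_lt A [set: T] ->
  card_lt ((A `*` [set: nat]) `*` (A `*` [set: nat])) [set: T].
Proof.
(* A finite [A] has a countably infinite product with [nat], so this case rests on the
   uncountability of [T]. *)
move=> AT; have [Afin|Ainf] := pselect (finite_set A).
  by apply: countable_card_lt; do !apply: countableX => //;
     exact: finite_set_countable.
apply: card_le_lt AT; have AA := card_setX_infinite Ainf.
have An : A `*` [set: nat] #<= A.
  apply: card_le_trans AA; apply: card_le_setX => //.
  exact/infiniteP.
exact: card_le_trans (card_le_setX An An) AA.
Qed.

Lemma card_lt_image2 {U V : Type} (f g : U -> V) (A : set U) :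
  card_lt A [set: T] -> card_lt (f @` A `|` g @` A) [set: T].
Proof.
move=> AT; have [Afin|Ainf] := pselect (finite_set A).
  apply: countable_card_lt; apply: finite_set_countable.
  by rewrite finite_setU; split; exact: finite_image.
by apply: card_le_lt AT; apply: card_le_setU => //; exact: card_image_le.
Qed.

End uncountable_card_lt.

(** * Good sets and families *)

(** One [f] serves both coordinates, as the pointwise maximum of two functions gives a ball inside
    both of theirs. *)
Lemma fan_star_closureP (T : choiceType) (S : set (fan T * fan T)) :
  closure S (fan_star T, fan_star T) <->
  forall f : T -> nat, exists p, [/\ S p, fan_ball f p.1 & fan_ball f p.2].
Proof.
split=> [clS f|SP B].
  have [|p [Sp [p1 p2]]] := clS (fan_ball f `*` fan_ball f); last by exists p.
  by exists (fan_ball f, fan_ball f) => //; split; exists f.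
case=> -[B1 B2] [/= [f _ fB1] [g _ gB2]] B12B.
have [p [Sp p1 p2]] := SP (fun a => maxn (f a) (g a)).
exists p; split => //; apply: B12B; split => /=.
  by apply: fB1; case: p.1 p1 => //= -[a n]; rewrite geq_max => /andP[].
by apply: gB2; case: p.2 p2 => //= -[a n]; rewrite geq_max => /andP[].
Qed.

Section families.
Variables (d : Order.disp_t) (Theta : orderType d).
Implicit Types (H : Theta -> Theta -> set (nat * nat)).

(** This and the next definition are conditions (a) and (b) of (3), stated without finiteness so as
    to apply to the weakened families too. *)
Definition avoided_on_small_sets H :=
  forall A : set Theta, card_lt A [set: Theta] ->
    exists f : Theta -> nat,
      forall a b : Theta, A a -> A b -> (a < b)%O -> ~ H a b (f a, f b).

Definition unavoidable H :=
  forall f : Theta -> nat, exists a b : Theta, (a < b)%O /\ H a b (f a, f b).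

Hypothesis Theta_uncountable : ~ countable [set: Theta].

Let Theta_nonempty : [set: Theta] !=set0.
Proof.
by apply/set0P/eqP => T0; apply: Theta_uncountable; rewrite T0; exact: countable0.
Qed.

(* Were the conclusion false, some [a] would have witnesses [b n] with
   [(n, m)] in the set of [{a, b n}] for all [m]; then the countable set
   [{a} `|` range b] could not be avoided. *)
Lemma section_bound H : avoided_on_small_sets H ->
  exists F : Theta -> nat, forall a b : Theta, (a < b)%O ->
    (exists m, ~ H a b (F a, m)) /\ (exists n, ~ H a b (n, F b)).
Proof.
move=> Hsmall.
suff key a : exists n, forall b, ((a < b)%O -> exists m, ~ H a b (n, m)) /\
                                 ((b < a)%O -> exists m, ~ H b a (m, n)).
  have [F FP] := choice key; exists F => a b ab.
  by split; [exact: (FP a b).1|exact: (FP b a).2].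
apply: contrapT => /forallNP bad.
have {}bad n : exists b, ((a < b)%O /\ forall m, H a b (n, m)) \/
                         ((b < a)%O /\ forall m, H b a (m, n)).
  have /existsNP[b nb] := bad n; exists b; apply: contrapT => /not_orP[nab nba].
  apply: nb; split=> lt; apply: contrapT => /forallNP nH.
    by apply: nab; split => // m; apply: contrapT.
  by apply: nba; split => // m; apply: contrapT.
have [b bP] := choice bad.
have [|f fP] := Hsmall (a |` range b).
  by apply: countable_card_lt => //; apply: card_le_setU infinite_nat _ _;
     [exact: countable1|exact: card_image_le].
have Ba : (a |` range b) a by left.
have Bb : (a |` range b) (b (f a)) by right; exists (f a).
by have [[lt Hm]|[lt Hm]] := bP (f a); [apply: (fP a _ Ba Bb lt)
  |apply: (fP _ a Bb Ba lt)]; exact: Hm.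
Qed.

(** Raise the indices to at least [F a] and [F b]. If [(n0, F b)] is not in [H a b], downward
    closure forces first indices below [n0]; likewise for second ones. The new sets are contained in
    the old, so avoiding functions survive; for unavoidability, replace [f] by its maximum with
    [F]. *)
Lemma finite_family H :
    (forall a b : Theta, (a < b)%O -> closed_downward (H a b)) ->
    avoided_on_small_sets H -> unavoidable H ->
  exists H', [/\ forall a b : Theta, (a < b)%O ->
    finite_set (H' a b) /\ closed_downward (H' a b),
    avoided_on_small_sets H' & unavoidable H'].
Proof.
move=> Hcd Hsmall Hall; have [F FP] := section_bound Hsmall.
exists (fun a b => [set p | H a b (maxn p.1 (F a), maxn p.2 (F b))]); split.
- move=> a b ab; split; last first.
    move=> n m n' m' /= Hnm nn' mm'; apply: (Hcd _ _ ab _ _ _ _ Hnm);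
      by rewrite geq_max leq_maxr andbT leq_max ?nn' ?mm'.
  have [[m0 Hm0] [n0 Hn0]] := FP a b ab.
  apply: (@sub_finite_set _ _ (`I_n0 `*` `I_m0)); last exact: finite_setX.
  move=> [n m] /= Hnm; split => /=; rewrite ltnNge; apply/negP => le.
    by apply: Hn0; apply: (Hcd _ _ ab _ _ _ _ Hnm); rewrite leq_max ?le ?leqnn ?orbT.
  by apply: Hm0; apply: (Hcd _ _ ab _ _ _ _ Hnm); rewrite leq_max ?le ?leqnn ?orbT.
- move=> A /Hsmall[f fA]; exists f => a b Aa Ab ab Hf.
  by apply: (fA a b Aa Ab ab); apply: (Hcd _ _ ab _ _ _ _ Hf); exact: leq_maxl.
- by move=> f; exact: (Hall (fun a => maxn (f a) (F a))).
Qed.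

Lemma family_of_theta_good (S : set (fan Theta * fan Theta)) : theta_good S ->
  exists H, [/\ forall a b : Theta, (a < b)%O -> closed_downward (H a b),
    avoided_on_small_sets H & unavoidable H].
Proof.
move=> [/fan_star_closureP clS Ssmall].
have small T : T `<=` S -> card_lt T [set: Theta] -> exists f : Theta -> nat,
    forall p, T p -> fan_ball f p.1 -> ~ fan_ball f p.2.
  move=> TS /(Ssmall _ TS); apply: contra_notP => /forallNP nf.
  apply/fan_star_closureP => f; apply: contrapT => /forallNP np.
  by apply: (nf f) => p Tp p1 p2; apply: (np p).
(* Both orders occur because a good set need not put the smaller index first. *)
exists (fun a b => [set p | exists i j, [/\ p.1 <= i, p.2 <= j &
  S (Some (a, i), Some (b, j)) \/ S (Some (b, j), Some (a, i))]]).
split.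
- move=> a b _ n m n' m' [i [j [/= ni mj Sij]]] n'n m'm.
  by exists i, j; split => //; [exact: leq_trans ni|exact: leq_trans mj].
- move=> A Asmall.
  pose T := S `&` (Some @` (A `*` [set: nat]) `*` Some @` (A `*` [set: nat])).
  have [||f fP] := small T; first exact: subIsetl.
    apply: (card_le_lt _ (card_lt_setX_nat Theta_uncountable Asmall)).
    apply: card_le_trans (subset_card_le (@subIsetr _ _ _)) _.
    by apply: card_le_setX; exact: card_image_le.
  exists f => a b Aa Ab ab [i [j [/= ai bj [Sij|Sij]]]].
    apply: (fP (Some (a, i), Some (b, j))) => //; split => //; split => /=;
      [by exists (a, i)|by exists (b, j)].
  apply: (fP (Some (b, j), Some (a, i))) => //; split => //; split => /=;
    [by exists (b, j)|by exists (a, i)].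
- move=> f.
  (* Points of [S] over a single index, or with a coordinate at the star, are invisible to the
     family. They lie in the square of some countable [K a], so a level [F a] excludes them. *)
  pose K a : set (fan Theta) := None |` [set Some (a, n) | n in [set: nat]].
  have KP a : exists n : nat, forall p, S p -> K a p.1 -> K a p.2 ->
      fan_ball (fun=> n) p.1 -> ~ fan_ball (fun=> n) p.2.
    have [||h hP] := small (S `&` (K a `*` K a)); first exact: subIsetl.
      apply: countable_card_lt => //.
      have cK : countable (K a) by apply: card_le_setU infinite_nat _ _;
        [exact: countable1|exact: card_image_le].
      apply: sub_countable (countableX cK cK).
      by apply: subset_card_le; exact: subIsetr.
    (* On [K a] the ball of [h] depends only on [h a]. *)
    exists (h a) => p Sp K1 K2 p1 p2; apply: (hP p) => //.
      by case: K1 p1 => [->|[n _ <-]].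
    by case: K2 p2 => [->|[n _ <-]].
  have [F FP] := choice KP.
  have [[[[a n]|] [[b m]|]] [/= Spq pn qm]] := clS (fun a => maxn (f a) (F a)).
  + move: pn qm; rewrite !geq_max => /andP[fn Fn] /andP[fm Fm].
    have [ab|ba|ab] := ltgtP a b.
    * by exists a, b; split => //; exists n, m; split => //; left.
    * by exists b, a; split => //; exists m, n; split => //; right.
    * move: Spq Fm; rewrite -ab => Spq Fm.
      by case: (FP a _ Spq) => //; right; [exists n|exists m].
  + move: pn; rewrite geq_max => /andP[_ Fn].
    by case: (FP a _ Spq) => //; [right; exists n|left].
  + move: qm; rewrite geq_max => /andP[_ Fm].
    by case: (FP b _ Spq) => //; [left|right; exists m].
  + have [t0 _] := Theta_nonempty.
    by case: (FP t0 _ Spq) => //; left.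
Qed.

(** A small subset of [S] involves few indices. A function [f] avoiding [H] on them gives a ball
    whose square misses the subset, by downward closure. *)
Lemma theta_good_of_family H :
    (forall a b : Theta, (a < b)%O -> closed_downward (H a b)) ->
    avoided_on_small_sets H -> unavoidable H ->
  exists S : set (fan Theta * fan Theta), theta_good S.
Proof.
move=> Hcd Hsmall Hall.
pose S := [set p | exists a b n m, [/\ (a < b)%O, H a b (n, m) &
  p = (Some (a, n), Some (b, m)) :> fan Theta * fan Theta]].
exists S; split.
  apply/fan_star_closureP => f; have [a [b [ab Hab]]] := Hall f.
  exists (Some (a, f a), Some (b, f b)); split => //=.
  by exists a, b, (f a), (f b).
move=> S' S'S S'small.
have [t0 _] := Theta_nonempty.
(* The default [t0] only makes [index] total: points of [S] have no coordinate at the star. *)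
pose index (q : fan Theta) := if q is Some (a, _) then a else t0.
have [|f fP] := Hsmall ([set index p.1 | p in S'] `|` [set index p.2 | p in S']).
  exact: card_lt_image2.
move=> /fan_star_closureP/(_ f)[p [S'p p1 p2]].
have [a [b [n [m [ab Hab pE]]]]] := S'S _ S'p.
move: S'p p1 p2; rewrite pE /= => S'p fn fm.
apply: (fP a b _ _ ab).
- by left; exists (Some (a, n), Some (b, m)).
- by right; exists (Some (a, n), Some (b, m)).
- exact: (Hcd _ _ ab _ _ _ _ Hab).
Qed.

End families.

(** * From spaces to families *)

Lemma first_countable_decreasing (X : topologicalType) : first_countable X ->
  exists V : X -> nat -> set X, [/\
    forall x n, open (V x n) /\ V x n x,
    forall x m n, m <= n -> V x n `<=` V x m &
    forall x A, nbhs x A -> exists n, V x n `<=` A].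
Proof.
move=> Xfc.
suff key x : exists V : nat -> set X, [/\ forall n, open (V n) /\ V n x,
    forall m n, m <= n -> V n `<=` V m &
    forall A, nbhs x A -> exists n, V n `<=` A].
  have [V VP] := choice key; exists V.
  by split=> x; have [] := VP x.
have [B Bcount [Bnbhs Bx]] := Xfc x.
have [g gP] : exists g : nat -> set X, forall A, B A -> exists n, g n = A.
  by move/pcard_surjP: Bcount => [g gP]; exists g => A /gP[n _ <-]; exists n.
(* The enumeration [g] covers [B] but may leave it, hence the guard [B (g i)]. *)
pose V n := \bigcap_(i in `I_n.+1) [set y | B (g i) -> (g i)° y].
have VS m n : m <= n -> V n `<=` V m.
  by move=> mn y Vy i /= im; apply: Vy => /=; exact: leq_trans im _.
exists V; split=> // [n|A /Bx[C BC CA]].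
  split; last by move=> i _ Bg; exact: Bnbhs.
  rewrite /V; elim: n.+1 => [|k IHk].
    by rewrite II0 bigcap_set0; exact: openT.
  rewrite IIS bigcap_setU bigcap_set1; apply: openI => //.
  have [Bg|nBg] := pselect (B (g k)).
    rewrite (_ : [set y | _] = (g k)°); first exact: open_interior.
    by apply/seteqP; split=> y //=; exact.
  by rewrite (_ : [set y | _] = setT); [exact: openT|
    by apply/seteqP; split=> // y _ /nBg].
have [n gn] := gP _ BC; exists n => y /(_ n (ltnSn n)) /=.
by rewrite gn => /(_ BC)/interior_subset/CA.
Qed.

Lemma closed_discrete_subset (X : topologicalType) (A B : set X) :
  B `<=` A -> closed_discrete A -> closed_discrete B.
Proof.
move=> BA [Acl Ais].
have iso x : A x -> exists2 V, nbhs x V & V `&` A `<=` [set x].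
  by move=> /Ais[_ [V Vx VA]]; exists V => //; rewrite VA.
split=> x Bx.
  (* A point in the closure of [B] lies in [A], and has a neighbourhood meeting [A] in that point
     alone; this neighbourhood also meets [B]. *)
  have [V Vx VA] := iso x (Acl x (closureS BA Bx)).
  have [y [By Vy]] := Bx V Vx.
  by have := VA y (conj Vy (BA _ By)) => <-.
split; first exact: mem_set.
have [V Vx VA] := iso x (BA _ Bx); exists V => //.
apply/seteqP; split=> [y [Vy By]|_ ->].
  by apply: VA; split => //; exact: BA.
by split => //; exact: nbhs_singleton.
Qed.

Lemma family_of_space (d : Order.disp_t) (Theta : orderType d)
    (X : topologicalType) :
    first_countable X -> lt_cwHausdorff X Theta -> ~ le_cwHausdorff X Theta ->
  exists H : Theta -> Theta -> set (nat * nat),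
    [/\ forall a b : Theta, (a < b)%O -> closed_downward (H a b),
    avoided_on_small_sets H & unavoidable H].
Proof.
move=> /first_countable_decreasing[V [Vopen Vdec Vbase]] Xlt.
move=> /existsNP[A /not_implyP[Acd /not_implyP[AT Ansep]]].
(* The set that cannot be separated has exactly the size of [Theta], as smaller ones can be; so
   [Theta] indexes it injectively. *)
have TA : ([set: Theta] #<= A).
  by apply: contrapT => TA; apply: Ansep; exact: Xlt.
have [e [e_inj e_range]] : exists e : Theta -> X, injective e /\ range e = A.
  have /card_bijP[f [g fK gK]] : ([set: Theta] #= A).
    by rewrite card_eq_le TA.
  have inT (a : Theta) : a \in [set: Theta] by rewrite inE.
  exists (fun a => val (f (SigSub (inT a)))); split.
    by move=> a b /val_inj/(can_inj fK)/(congr1 val).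
  apply/seteqP; split=> [_ [a _ <-]|x Ax]; first exact/set_mem/valP.
  exists (val (g (SigSub (mem_set Ax)))) => //.
  rewrite (_ : SigSub _ = g (SigSub (mem_set Ax))) ?gK//.
  exact: val_inj.
exists (fun a b => [set p | V (e a) p.1 `&` V (e b) p.2 !=set0]); split.
- move=> a b _ n m n' m' [x [/= Vx Vx']] n'n m'm.
  by exists x; split=> /=; [exact: Vdec n'n _ Vx|exact: Vdec m'm _ Vx'].
- move=> B Bsmall.
  have [||U [Uopen Utriv]] := Xlt (e @` B).
  + by apply: closed_discrete_subset Acd; rewrite -e_range; exact: image_subset.
  + by apply: card_le_lt Bsmall; exact: card_image_le.
  have /choice[f fU] : forall a, exists n, B a -> V (e a) n `<=` U (e a).
    move=> a; have [Ba|nBa] := pselect (B a); last by exists 0 => /nBa.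
    have [|Ua Uea] := Uopen (e a); first by exists a.
    by have [|n] := Vbase (e a) (U (e a)); [exact: open_nbhs_nbhs|exists n].
  exists f => a b Ba Bb ab [x [/= Vx Vx']].
  have /e_inj abE : e a = e b.
    apply: Utriv; [by exists a|by exists b|].
    by exists x; split; [exact: fU Vx|exact: fU Vx'].
  by rewrite abE ltxx in ab.
- move=> f; apply: contrapT => nH; apply: Ansep.
  have disj a b : (a < b)%O -> V (e a) (f a) `&` V (e b) (f b) = set0.
    move=> ab; apply/eqP/negP => /negP/set0P Vab; apply: nH.
    by exists a, b.
  (* For [x] in [A] the union has a single term; this form avoids an inverse of [e]. *)
  exists (fun x => \bigcup_(a in e @^-1` [set x]) V (e a) (f a)); split.
    move=> x Ax; split; first by apply: bigcup_open => a _; exact: (Vopen _ _).1.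
    have [a _ ax] : range e x by rewrite e_range.
    by exists a => //; rewrite -ax; exact: (Vopen _ _).2.
  move=> _ _ _ _ [x [[a /= <- Va] [b /= <- Vb]]].
  have [ab|ba|-> //] := ltgtP a b.
    by have : set0 x by rewrite -(disj a b ab).
  by have : set0 x by rewrite -(disj b a ba).
Qed.

(** * From finite families to spaces *)

(* [H] only serves to attach the topology to the type.  Points
   [inr ((a, i), (b, j))] outside of the intended range [a < b] and
   [H a b (i, j)] are isolated and lie in no ball. *)
Definition ladder_space (d : Order.disp_t) (Theta : orderType d)
  (H : Theta -> Theta -> set (nat * nat)) : Type :=
  (Theta + (Theta * nat) * (Theta * nat))%type.

Lemma finite_nat2_bound (A : set (nat * nat)) : finite_set A ->
  exists N, forall i j, A (i, j) -> i < N /\ j < N.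
Proof.
move=> /finite_seqP[s ->]; exists (\max_(p <- s) maxn p.1 p.2).+1 => i j /= ijs.
have := @leq_bigmax_seq _ s xpredT (fun p => maxn p.1 p.2) _ ijs isT.
by rewrite !ltnS geq_max => /andP[].
Qed.

Section ladder_space.
Variables (d : Order.disp_t) (Theta : orderType d).
Variable H : Theta -> Theta -> set (nat * nat).
Hypothesis Hfin : forall a b : Theta, (a < b)%O -> finite_set (H a b).
Hypothesis Hdown : forall a b : Theta, (a < b)%O -> closed_downward (H a b).
Local Notation X := (ladder_space H).

HB.instance Definition _ := Choice.on X.

(** The point [inr ((b, i), (c, j))] witnesses that [(i, j)] is in [H b c]: it belongs to the balls
    of [b] of index at most [i] and those of [c] of index at most [j]. *)
Definition ladder_ball (a : Theta) (n : nat) : set X :=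
  [set p : X | match p with
   | inl c => c = a
   | inr ((b, i), (c, j)) => [/\ (b < c)%O, H b c (i, j) &
       b = a /\ n <= i \/ c = a /\ n <= j]
   end].

Definition ladder_nbhs (p : X) : set_system X :=
  if p is inl a then filter_from [set: nat] (ladder_ball a) else principal_filter p.

Let ladder_ballS a m n : m <= n -> ladder_ball a n `<=` ladder_ball a m.
Proof.
move=> mn [c|[[b i] [c j]]] //= [bc Hbc ninj]; split => //.
by case: ninj => -[-> nle]; [left|right]; split => //; exact: leq_trans mn nle.
Qed.

Let ladder_nbhs_filter (p : X) : ProperFilter (ladder_nbhs p).
Proof.
case: p => [a|p] /=; last exact: principal_filter_proper.
apply: filter_from_proper; last by move=> n _; exists (inl a).
apply: filter_from_filter; first by exists 0.
move=> m n _ _; exists (maxn m n) => //.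
by rewrite subsetI; split; apply: ladder_ballS; rewrite ?leq_maxl ?leq_maxr.
Qed.

Let ladder_nbhs_singleton (p : X) (A : set X) : ladder_nbhs p A -> A p.
Proof.
case: p => [a [n _ nA]|p /principal_filterP//]; exact: nA.
Qed.

Let ladder_nbhs_nbhs (p : X) (A : set X) :
  ladder_nbhs p A -> ladder_nbhs p (ladder_nbhs^~ A).
Proof.
case: p => [a [n _ nA]|p]; last by move=> Ap; apply/principal_filterP.
exists n => // -[c /= ->|p /nA Ap]; first by exists n.
by apply/principal_filterP.
Qed.

HB.instance Definition _ := hasNbhs.Build X ladder_nbhs.
HB.instance Definition _ := @Nbhs_isNbhsTopological.Build X
  ladder_nbhs_filter ladder_nbhs_singleton ladder_nbhs_nbhs.

Let nbhs_ball a n : nbhs (inl a : X) (ladder_ball a n).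
Proof. by exists n. Qed.

Let nbhs_isolated p : nbhs (inr p : X) [set inr p].
Proof. by apply/principal_filterP. Qed.

Let closure_isolated p (A : set X) : closure A (inr p) -> A (inr p).
Proof. by move=> /(_ _ (@nbhs_isolated p))[x [Ax xp]]; rewrite -xp. Qed.

(** As [a < b], a common point must be [inr ((a, i), (b, j))] with [n <= i] and [m <= j]; downward
    closure brings [(i, j)] to [(n, m)]. *)
Let ladder_ballI a b n m p : (a < b)%O ->
  ladder_ball a n p -> ladder_ball b m p -> H a b (n, m).
Proof.
move=> ab; case: p => [c|[[x i] [y j]]] /=.
  by move=> -> ba; rewrite ba ltxx in ab.
move=> [xy Hxy [[xa ni]|[ya nj]]] [_ _ [[xb mi]|[yb mj]]].
- by rewrite -xa -xb ltxx in ab.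
- by rewrite xa yb in Hxy; exact: (Hdown ab Hxy).
- by move: xy; rewrite ya xb ltNge ltW.
- by rewrite -ya -yb ltxx in ab.
Qed.

Let clopen_ball a n : clopen (ladder_ball a n).
Proof.
split.
  rewrite openE => -[c /= ->|p np]; first exact: nbhs_ball.
  exact/principal_filterP.
move=> [c|p] clp; last exact: closure_isolated.
(* By finiteness, [N] exceeds both entries of every pair in the set attached to [a] and [c], so the
   ball of [c] of index [N] misses that of [a]. *)
have [N] : exists N, a <> c -> forall p, ladder_ball a n p -> ~ ladder_ball c N p.
  have [ac|ca|->] := ltgtP a c; last by exists 0.
    have [N NP] := finite_nat2_bound (Hfin ac); exists N => _ p pa pc.
    by have [_] := NP _ _ (ladder_ballI ac pa pc); rewrite ltnn.
  have [N NP] := finite_nat2_bound (Hfin ca); exists N => _ p pa pc.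
  by have [] := NP _ _ (ladder_ballI ca pc pa); rewrite ltnn.
have [p [pa pc]] := clp _ (@nbhs_ball c N).
have [->//|ac] := pselect (a = c).
by move=> /(_ ac p pa).
Qed.

Let clopen_isolated p : clopen [set inr p : X].
Proof.
split; first by rewrite openE => _ ->; exact: nbhs_isolated.
move=> [c|q]; last exact: closure_isolated.
case: p => [[a i] [b j]] clc.
(* An index above both [i] and [j] leaves the point out of the ball of [c]. *)
have [_ [-> /= [_ _]]] := clc _ (@nbhs_ball c (maxn i j).+1).
by rewrite !ltnNge leq_maxl leq_maxr => -[[]|[]].
Qed.

Lemma ladder_first_countable : first_countable X.
Proof.
case=> [a|p].
  exists (range (ladder_ball a)); first exact: card_image_le.
  split=> [_ [n _ <-]|A [n _ nA]]; first exact: nbhs_ball.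
  by exists (ladder_ball a n) => //; exists n.
exists [set [set inr p]]; first exact: countable1.
split=> [_ ->|A /nbhs_singleton Ap]; first exact: nbhs_isolated.
by exists [set inr p] => // _ ->.
Qed.

Lemma ladder_clopen_basis : has_clopen_basis X.
Proof.
exists [set U | (exists a n, U = ladder_ball a n) \/ exists p, U = [set inr p]].
  split=> [_ [[a [n ->]]|[p ->]]|x A xA]; first exact: (clopen_ball _ _).1.
    exact: (clopen_isolated _).1.
  case: x xA => [a [n _ nA]|p /nbhs_singleton Ap].
    by exists (ladder_ball a n) => //; split; [left; exists a, n|].
  by exists [set inr p] => [|_ ->//]; split; [right; exists p|].
by move=> _ [[a [n ->]]|[p ->]]; [exact: clopen_ball|exact: clopen_isolated].
Qed.

Lemma ladder_lt_cwHausdorff : avoided_on_small_sets H -> lt_cwHausdorff X Theta.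
Proof.
move=> Hsmall A [Acl Ais] Asmall.
have [|f fP] := Hsmall (inl @^-1` A).
  apply: card_le_lt Asmall; apply: (@card_le_inj _ _ _ _ inl) => // a b _ _.
  by case.
have /choice[g gP] : forall a, exists n,
    A (inl a) -> ladder_ball a n `&` A `<=` [set inl a].
  move=> a; have [Aa|nAa] := pselect (A (inl a)); last by exists 0 => /nAa.
  have [_ [V [n _ nV] VA]] := Ais _ Aa; exists n => _ p [np Ap].
  by rewrite -VA; split => //; exact: nV.
(* The bound [f] makes the balls disjoint from each other, and [g] keeps them off the isolated
   points of [A]. *)
pose r a := maxn (f a) (g a).
have ball_isolated a p : A (inl a) -> A (inr p) -> ~ ladder_ball a (r a) (inr p).
  move=> Aa Ap /(ladder_ballS (leq_maxr _ _)) pa.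
  by have := gP a Aa _ (conj pa Ap).
have ball_disjoint a b p : A (inl a) -> A (inl b) -> (a < b)%O ->
    ladder_ball a (r a) p -> ~ ladder_ball b (r b) p.
  move=> Aa Ab ab pa pb; apply: (fP a b Aa Ab ab).
  exact: ladder_ballI ab (ladder_ballS (leq_maxl _ _) pa)
    (ladder_ballS (leq_maxl _ _) pb).
exists (fun p : X => if p is inl a then ladder_ball a (r a) else [set p]).
split=> [[a _|p _]|[a|p] [b|q] Aa Ab [x []]].
- by split => //; exact: (clopen_ball _ _).1.
- by split => //; exact: (clopen_isolated _).1.
- have [ab|ba|-> //] := ltgtP a b => xa xb; exfalso.
    exact: ball_disjoint ab xa xb.
  exact: ball_disjoint ba xb xa.
- by move=> /[swap] -> /ball_isolated; case.
- by move=> -> /ball_isolated; case.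
- by move=> -> ->.
Qed.

(** The copy of [Theta] is closed discrete. A separation would shrink to balls of indices [f a], and
    unavoidability makes two of these share the point [inr ((a, f a), (b, f b))]. *)
Lemma ladder_not_le_cwHausdorff : unavoidable H -> ~ le_cwHausdorff X Theta.
Proof.
move=> Hall /(_ (range inl))[||U [Uopen Utriv]].
- split=> [[a _|p]|_ [a _ <-]]; first by exists a.
    by move=> /closure_isolated[].
  split; first by rewrite inE; exists a.
  exists (ladder_ball a 0); first exact: nbhs_ball.
  apply/seteqP; split=> [p [pa [b _ bE]]|_ ->]; last by split=> //; exists a.
  by move: pa; rewrite -bE /= => ->.
- exact: card_image_le.
have /choice[f fU] : forall a, exists n, ladder_ball a n `<=` U (inl a).
  move=> a; have [|Ua Uaa] := Uopen (inl a); first by exists a.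
  have [n _ nU] : nbhs (inl a : X) (U (inl a)) := open_nbhs_nbhs (conj Ua Uaa).
  by exists n.
have [a [b [ab Hab]]] := Hall f.
suff [abE] : inl a = inl b :> X by rewrite abE ltxx in ab.
apply: Utriv; [by exists a|by exists b|exists (inr ((a, f a), (b, f b)))].
by split; apply: fU => /=; split => //; [left|right].
Qed.

End ladder_space.

(** * The cycle of implications from (1) through (2), (3) and (4) back to (1) *)

Theorem theorem1 (d : Order.disp_t) (Theta : orderType d)
    (Theta_cardinal : cardinal_order Theta)
    (Theta_uncountable : ~ countable [set: Theta]) :
  [<-> (* (1) *)
       exists S : set (fan Theta * fan Theta)%type, theta_good S ;
       (* (2) *)
       exists X : topologicalType,
         [/\ first_countable X,
             lt_cwHausdorff X Theta &
             ~ le_cwHausdorff X Theta] ;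
       (* (3) *)
       exists H : Theta -> Theta -> set (nat * nat)%type,
         [/\ forall a b : Theta, (a < b)%O ->
               finite_set (H a b) /\ closed_downward (H a b),
             forall A : set Theta, card_lt A [set: Theta] ->
               exists f : Theta -> nat,
                 forall a b : Theta, A a -> A b -> (a < b)%O ->
                   ~ H a b (f a, f b) &
             forall f : Theta -> nat,
               exists a b : Theta, (a < b)%O /\ H a b (f a, f b)] ;
       (* (4) *)
       exists X : topologicalType,
         [/\ first_countable X,
             has_clopen_basis X,
             lt_cwHausdorff X Theta &
             ~ le_cwHausdorff X Theta]].
Proof.
have space H : (forall a b : Theta, (a < b)%O ->
      finite_set (H a b) /\ closed_downward (H a b)) ->
    avoided_on_small_sets H -> unavoidable H ->
    exists X : topologicalType, [/\ first_countable X, has_clopen_basis X,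
      lt_cwHausdorff X Theta & ~ le_cwHausdorff X Theta].
  move=> HP Hsmall Hall.
  have Hfin a b : (a < b)%O -> finite_set (H a b) by move=> /HP[].
  have Hdown a b : (a < b)%O -> closed_downward (H a b) by move=> /HP[].
  exists (ladder_space H); split.
  - exact: ladder_first_countable.
  - exact: ladder_clopen_basis.
  - exact: ladder_lt_cwHausdorff.
  - exact: ladder_not_le_cwHausdorff.
have family_of (X : topologicalType) : first_countable X ->
    lt_cwHausdorff X Theta -> ~ le_cwHausdorff X Theta ->
    exists H : Theta -> Theta -> set (nat * nat), [/\
      forall a b : Theta, (a < b)%O -> finite_set (H a b) /\ closed_downward (H a b),
      avoided_on_small_sets H & unavoidable H].
  move=> Xfc Xlt Xle; have [H [Hdown Hsmall Hall]] := family_of_space Xfc Xlt Xle.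
  exact: (finite_family Theta_uncountable Hdown Hsmall Hall).
tfae.
(* From (1) to (2) by way of a finite family, forgetting the clopen base of its space. *)
- move=> [S /(family_of_theta_good Theta_uncountable)[H [Hdown Hsmall Hall]]].
  have [H' [H'P H'small H'all]] :=
    finite_family Theta_uncountable Hdown Hsmall Hall.
  by have [X [? _ ? ?]] := space H' H'P H'small H'all; exists X.
- by move=> [X [Xfc Xlt Xle]]; exact: family_of Xfc Xlt Xle.
- by move=> [H [HP Hsmall Hall]]; exact: space HP Hsmall Hall.
- move=> [X [Xfc _ Xlt Xle]].
  have [H [HP Hsmall Hall]] := family_of X Xfc Xlt Xle.
  by apply: theta_good_of_family Hsmall Hall => // a b /HP[].
Qed.
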